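(* Let $(c,\lambda/\mu)$ be a placed skew shape with $n$ boxes and let $\tilde H^{(c,\lambda/\mu)}$ be the associated $\tilde H_n$-module with basis $\{v_L\}$. Let $C$ be the column reading tableau of shape $\lambda/\mu$ and let $wC$ denote the tableau $C$ with the entries permuted according to the permutation $w$. For each standard tableau $L$ of shape $\lambda/\mu$ let $n_L=T_wv_C$, where $w\in S_n$ is the permutation such that $L=wC$. Then $\{n_L \mid L \text{ a standard tableau of shape } \lambda/\mu\}$ is a basis of $\tilde H^{(c,\lambda/\mu)}$.
   Context: **Algebra.** Fix $q\in\mathbb C^*$ which is not a root of unity. The affine Hecke algebra $\tilde H_n$ is the unital associative $\mathbb C$-algebra generated by $T_1,\dots,T_{n-1}$ and invertible elements $x_1,\dots,x_n$ with relations: $T_iT_j=T_jT_i$ if $|i-j|>1$; $T_iT_{i+1}T_i=T_{i+1}T_iT_{i+1}$ for $1\le i\le n-2$; $T_i^2=(q-q^{-1})T_i+1$; $x_ix_j=x_jx_i$; and for $\gamma\in\mathbb Z^n$, $x^\gamma=x_1^{\gamma_1}\cdots x_n^{\gamma_n}$, $$x^\gamma T_i=T_ix^{s_i\gamma}+(q-q^{-1})\frac{(x^\gamma-x^{s_i\gamma})x_{i+1}}{x_{i+1}-x_i},$$ where $s_i=(i,i+1)$ swaps coordinates $i,i+1$ of $\gamma$. For $w\in S_n$ with reduced word $w=s_{i_1}\cdots s_{i_p}$, $T_w=T_{i_1}\cdots T_{i_p}$ (independent of the reduced word). **Skew shapes.** Partitions are drawn with boxes pushed up and to the left; rows and columns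 are numbered as for matrices. For partitions $\mu\subseteq\lambda$, the skew shape $\lambda/\mu$ consists of the boxes of $\lambda$ not in $\mu$. A box in row $r$, column $s$ lies on the diagonal of index $s-r$. The boxes are numbered $\mathrm{box}_1,\dots,\mathrm{box}_n$ along diagonals from southwest to northeast (increasing index; northwest to southeast within a diagonal). A standard tableau of shape $\lambda/\mu$ is a filling of the boxes with $1,\dots,n$ increasing left to right in each row and top to bottom in each column. The column reading tableau $C$ is the standard tableau obtained by entering $1,2,\dots,n$ consecutively down the columns of $\lambda/\mu$, beginning with the southwest-most connected component and filling the columns from left to right. **Placed skew shapes.** Let $\mathbb R+i[0,2\pi/\ln(q^2))=\{a+bi\mid a\in\mathbb R,\ 0\le b<2\pi/\ln(q^2)\}\subseteq\mathbb C$. If $q$ is a positive real number then $x\mapsto q^{2x}=e^{\ln(q^2)x}$ is a bijection from this set to $\mathbb C^*$. A placed skew shape is a pair $(c,\lambda/\mu)$ of a skew shape $\lambda/\mu$ and a content function $c$ from the boxes of $\lambda/\mu$ to $\mathbb R+i[0,2\pi/\ln(q^2))$ such that: $c(\mathrm{box}_j)\ge c(\mathrm{box}_i)$ if $i<j$ and $c(\mathrm{box}_j)-c(\mathrm{box}_i)\in\mathbb Z$; $c(\mathrm{box}_j)=c(\mathrm{box}_i)+1$ iff $\mathrm{box}_i$ and $\mathrm{box}_j$ are on adjacent diagonals, that of $\mathrm{box}_j$ having index one more than that of $\mathrm{box}_i$; $c(\mathrm{box}_i)=c(\mathrm{box}_j)$ iff they are on the same diagonal. **The module.** $\tilde H^{(c,\lambda/\mu)}$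 is the $\tilde H_n$-module with $\mathbb C$-basis $\{v_L\}$, $L$ running over standard tableaux of shape $\lambda/\mu$, and action $$x_iv_L=q^{2c(L(i))}v_L,\qquad T_iv_L=(T_i)_{LL}v_L+(q^{-1}+(T_i)_{LL})v_{s_iL},\qquad (T_i)_{LL}=\frac{q-q^{-1}}{1-q^{2(c(L(i))-c(L(i+1)))}},$$ where $L(i)$ is the box of $L$ containing $i$, $s_iL$ is $L$ with the entries $i,i+1$ interchanged, and $v_{s_iL}=0$ if $s_iL$ is not standard. *)

(* Defs.v *)
From mathcomp Require Import all_boot all_order all_algebra all_fingroup.
From mathcomp Require Import reals sequences exp trigo complex.
From mathcomp Require Import ring.

Set Implicit Arguments.
Unset Strict Implicit.
Unset Printing Implicit Defensive.

Import Order.TTheory GRing.Theory Num.Theory.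
Local Open Scope ring_scope.

(** * Simple transpositions and reduced words

    Indices are 0-based: [i : 'I_n.-1] stands for s_{i+1} = (i+1, i+2). *)

Lemma idx_succ_subproof n (i : 'I_n.-1) : (i.+1 < n)%N.
Proof. by case: n i => [|n] [i Hi]. Qed.

Definition idx n (i : 'I_n.-1) : 'I_n := widen_ord (leq_pred n) i.
Definition idxS n (i : 'I_n.-1) : 'I_n := Ordinal (idx_succ_subproof i).
Definition simple_tr n (i : 'I_n.-1) : 'S_n := tperm (idx i) (idxS i).

(* s_{i_1} ... s_{i_p}, composed as functions (rightmost factor first);
   MathComp's product of permutations composes in the opposite order. *)
Definition word_perm n (u : seq 'I_n.-1) : 'S_n :=
  foldr (fun i w => (w * simple_tr i)%g) 1%g u.

Definition reduced_word n (u : seq 'I_n.-1) (w : 'S_n) : Prop :=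
  word_perm u = w /\
  forall u' : seq 'I_n.-1, word_perm u' = w -> (size u <= size u')%N.

(** * The affine Hecke algebra *)

Section LaurentMonomials.
Variables (A : nzRingType) (n : nat) (x xV : 'I_n -> A).

Definition xpow (j : 'I_n) (z : int) : A :=
  if 0 <= z then x j ^+ `|z|%N else xV j ^+ `|z|%N.

Definition xmon (g : 'I_n -> int) : A := \prod_(j < n) xpow j (g j).

Definition set_exp (g : 'I_n -> int) (i : 'I_n.-1) (a b : int) : 'I_n -> int :=
  fun j => if j == idx i then a else if j == idxS i then b else g j.

(* The Laurent polynomial (x^g - x^{s_i g}) x_{i+1} / (x_{i+1} - x_i), with the
   division carried out; see [xmon_quotE]. *)
Definition xmon_quot (i : 'I_n.-1) (g : 'I_n -> int) : A :=
  let a := g (idx i) in let b := g (idxS i) in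
  if a <= b then \sum_(k < `|b - a|%N) xmon (set_exp g i (a + k%:Z) (b - k%:Z))
  else - \sum_(k < `|a - b|%N) xmon (set_exp g i (b + k%:Z) (a - k%:Z)).

End LaurentMonomials.

Section LaurentMonomialsTheory.
Variables (F : fieldType) (n : nat) (x : 'I_n -> F).
Hypothesis x_neq0 : forall j, x j != 0.
Let xV j := (x j)^-1.

Lemma xmonE g : xmon x xV g = \prod_(j < n) x j ^ g j.
Proof.
apply: eq_bigr => j _; rewrite /xpow; case: (g j) => m //=.
by rewrite /xV exprVn.
Qed.

Lemma xmon_quotE (i : 'I_n.-1) g : x (idxS i) != x (idx i) ->
  xmon_quot x xV i g =
  (xmon x xV g - xmon x xV (g \o simple_tr i)) * x (idxS i)
    / (x (idxS i) - x (idx i)).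
Proof.
move=> neq; have nz : x (idxS i) - x (idx i) != 0 by rewrite subr_eq0.
have ne : idxS i != idx i by rewrite -val_eqE /= eqn_leq ltnn.
pose P := \prod_(j < n | (j != idx i) && (j != idxS i)) x j ^ g j.
have split2 h : xmon x xV h = x (idx i) ^ h (idx i) * (x (idxS i) ^ h (idxS i) *
    \prod_(j < n | (j != idx i) && (j != idxS i)) x j ^ h j).
  by rewrite xmonE (bigD1 (idx i)) //= (bigD1 (idxS i)).
have setE a b : xmon x xV (set_exp g i a b) =
    x (idx i) ^ a * (x (idxS i) ^ b * P).
  rewrite split2 /set_exp eqxx (negPf ne) eqxx; congr (_ * (_ * _)).
  by apply: eq_bigr => j /andP[/negPf-> /negPf->].
have swapE : xmon x xV (g \o simple_tr i) =
    x (idx i) ^ g (idxS i) * (x (idxS i) ^ g (idx i) * P).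
  rewrite split2 /= /simple_tr tpermL tpermR; congr (_ * (_ * _)).
  by apply: eq_bigr => j /andP[j1 j2]; rewrite /= tpermD // eq_sym.
rewrite swapE split2 -/P /xmon_quot.
move: (g (idx i)) (g (idxS i)) => a b.
set u := x (idx i) in nz setE *; set v := x (idxS i) in nz setE *.
have unz : u != 0 by exact: x_neq0.
have vnz : v != 0 by exact: x_neq0.
have sumE c d m : d = c + m%:Z ->
    \sum_(k < m) xmon x xV (set_exp g i (c + k%:Z) (d - k%:Z)) =
    (u ^ c * (v ^ d * P) - u ^ d * (v ^ c * P)) * v / (v - u).
  move=> ->; apply: (mulIf nz); rewrite mulfVK // big_distrl /=.
  pose G k := - (u ^ (c + k%:Z) * (v ^ (c + m%:Z - k%:Z) * v * P)).
  have stepE (k : 'I_m) : true ->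
      xmon x xV (set_exp g i (c + k%:Z) (c + m%:Z - k%:Z)) * (v - u)
      = G k.+1 - G k.
    move=> _; rewrite setE /G -!mulrA.
    have -> : c + k.+1%:Z = c + k%:Z + 1 by rewrite -addn1 PoszD addrA.
    have -> : c + m%:Z - k%:Z = c + m%:Z - k.+1%:Z + 1.
      by rewrite -[k.+1]addn1 PoszD opprD addrA subrK.
    rewrite (expfzDr (c + k%:Z) 1 unz) (expfzDr (c + m%:Z - k.+1%:Z) 1 vnz) !expr1z.
    by ring.
  rewrite (eq_bigr _ stepE) -(big_mkord xpredT (fun k => G k.+1 - G k)).
  rewrite telescope_sumr // /G addr0 subr0 addrK.
  by ring.
have distE (d c : int) : c <= d -> d = c + `|d - c|%N%:Z.
  by move=> le_cd; rewrite gez0_abs ?subr_ge0 // subrKC.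
case: ifP => [le_ab | /negbT]; last rewrite -ltNge => /ltW le_ba.
  by rewrite (sumE _ _ _ (distE _ _ le_ab)).
by rewrite (sumE _ _ _ (distE _ _ le_ba)) -2!mulNr opprB.
Qed.

End LaurentMonomialsTheory.

Section AffineHecke.
Variables (K : fieldType) (q : K) (n : nat).

(* [xV j] is the inverse of the generator [x j]. *)
Definition affine_Hecke_relations (A : algType K)
    (T : 'I_n.-1 -> A) (x xV : 'I_n -> A) : Prop :=
  [/\ forall j, x j * xV j = 1 /\ xV j * x j = 1,
      forall i j, x i * x j = x j * x i,
      forall i j : 'I_n.-1, (i.+1 < j)%N || (j.+1 < i)%N ->
        T i * T j = T j * T i,
      forall i j : 'I_n.-1, j = i.+1 :> nat ->
        T i * T j * T i = T j * T i * T j &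
      (forall i, T i * T i = (q - q^-1) *: T i + 1) /\
      forall (i : 'I_n.-1) (g : 'I_n -> int),
        xmon x xV g * T i =
          T i * xmon x xV (g \o simple_tr i) + (q - q^-1) *: xmon_quot x xV i g].

Definition is_affine_Hecke_algebra (H : algType K)
    (T : 'I_n.-1 -> H) (x xV : 'I_n -> H) : Prop :=
  [/\ affine_Hecke_relations T x xV,
      forall (A : algType K) (T' : 'I_n.-1 -> A) (x' xV' : 'I_n -> A),
        affine_Hecke_relations T' x' xV' ->
        exists phi : {lrmorphism H -> A},
          (forall i, phi (T i) = T' i) /\ (forall j, phi (x j) = x' j) &
      forall (A : algType K) (phi psi : {lrmorphism H -> A}),
        (forall i, phi (T i) = psi (T i)) ->
        (forall j, phi (x j) = psi (x j)) -> phi =1 psi].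

(* [Tw] assigns to each permutation the product of the T_i along some reduced
   word of it. *)
Definition is_Tw (H : algType K) (T : 'I_n.-1 -> H) (Tw : 'S_n -> H) : Prop :=
  forall w, exists2 u, reduced_word u w & Tw w = \prod_(i <- u) T i.

End AffineHecke.

(* [v] is a K-basis of the module [M] over the K-algebra [H]; scalars of K act
   through K -> H. *)
Definition is_basis (K : fieldType) (H : algType K) (M : lmodType H)
    (I : finType) (v : I -> M) : Prop :=
  forall m : M, exists! f : {ffun I -> K}, m = \sum_i (f i)%:A *: v i.

(** * Skew shapes and tableaux *)

Definition is_part (s : seq nat) : bool := sorted geq s && (0%N \notin s).

Definition is_skew_shape (lam mu : seq nat) : Prop :=
  [/\ is_part lam, is_part mu & forall r, (nth 0 mu r <= nth 0 lam r)%N].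

(* Row and column indices are 0-based. *)
Definition in_skew (lam mu : seq nat)
    (p : 'I_(size lam) * 'I_(nth 0%N lam 0)) : bool :=
  (nth 0 mu p.1 <= p.2 < nth 0 lam p.1)%N.

Definition box (lam mu : seq nat) := {p | @in_skew lam mu p}.

Section Tableaux.
Variables lam mu : seq nat.
Implicit Types b : box lam mu.

Definition brow b : nat := (val b).1.
Definition bcol b : nat := (val b).2.
Definition bdiag b : int := (bcol b)%:Z - (brow b)%:Z.

(* b comes before b' in the numbering box_1, ..., box_n: by diagonals from
   southwest to northeast, then northwest to southeast within a diagonal. *)
Definition box_lt b b' : bool :=
  (bdiag b < bdiag b') || (bdiag b == bdiag b') && (brow b < brow b')%N.

Variable n : nat.

(* A filling of the boxes with 1, ..., n is stored as the map sending i to the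
   box L(i) containing i (0-based).  When the shape has n boxes, injectivity
   makes it a bijection. *)
Definition standard (t : {ffun 'I_n -> box lam mu}) : bool :=
  [&& injectiveb t,
      [forall i, forall j, (brow (t i) == brow (t j)) &&
                           (bcol (t i) < bcol (t j))%N ==> (i < j)%N] &
      [forall i, forall j, (bcol (t i) == bcol (t j)) &&
                           (brow (t i) < brow (t j))%N ==> (i < j)%N]].

Definition syt := {t | standard t}.

(* The tableau w t: the entry k of t becomes w k, so i sits in the box which
   contained w^-1 i. *)
Definition perm_tab (w : 'S_n) (t : {ffun 'I_n -> box lam mu}) :
    {ffun 'I_n -> box lam mu} := [ffun i => t (w^-1%g i)].

(* A column of a skew shape lies in one connected component, and the components
   further southwest occupy columns further left.  So reading the components
   from southwest to northeast, each by columns from left to right, is reading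
   all the columns from left to right. *)
Definition is_column_reading (t : {ffun 'I_n -> box lam mu}) : Prop :=
  forall i j : 'I_n, (i < j)%N =
    (bcol (t i) < bcol (t j))%N ||
    (bcol (t i) == bcol (t j)) && (brow (t i) < brow (t j))%N.

End Tableaux.

(** * Placed skew shapes and their modules *)

Section Placed.
Variable R : realType.
Local Notation C := R[i].
Local Open Scope complex_scope.

Definition cexp (z : C) : C :=
  (expR (complex.Re z))%:C * (cos (complex.Im z) +i* sin (complex.Im z)).

Definition not_root_of_unity (q : C) : Prop :=
  forall k : nat, (0 < k)%N -> q ^+ k != 1.

(* [lnq2] is a logarithm of q^2. *)
Variables (q lnq2 : C).

(* q^{2 z} *)
Definition qpow2 (z : C) : C := cexp (lnq2 * z).

(* The strip R + i[0, 2 pi / ln(q^2)): for real q > 1 and the real logarithm of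
   q^2 the bound below is 2 pi / ln(q^2) itself.  For other q with |q| <> 1, it
   is the height of a horizontal strip which [qpow2] maps bijectively onto C^*;
   such a strip does not exist when |q| = 1, and the set is then empty. *)
Definition in_strip (z : C) : bool :=
  0 <= complex.Im z < `| complex.Re ((pi *+ 2)%:C / lnq2) |.

Variables lam mu : seq nat.

(* [<=] on C compares numbers with the same imaginary part. *)
Definition is_placed (c : box lam mu -> C) : Prop :=
  [/\ forall b, in_strip (c b),
      forall b b', box_lt b b' ->
        (exists z : int, c b' - c b = z%:~R) -> c b <= c b',
      forall b b', c b' = c b + 1 <-> bdiag b' = bdiag b + 1 &
      forall b b', c b = c b' <-> bdiag b = bdiag b'].

Variables (n : nat) (c : box lam mu -> C).

(* (T_i)_{LL} *)
Definition Tdiag (i : 'I_n.-1) (L : syt lam mu n) : C :=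
  (q - q^-1) / (1 - qpow2 (c (val L (idx i)) - c (val L (idxS i)))).

(* [v] is a basis of [M] on which the generators act by the formulas defining
   the module of the placed skew shape (c, lam/mu). *)
Definition is_skew_module (H : algType C) (T : 'I_n.-1 -> H) (x : 'I_n -> H)
    (M : lmodType H) (v : syt lam mu n -> M) : Prop :=
  [/\ is_basis v,
      forall i L, x i *: v L = (qpow2 (c (val L i)))%:A *: v L &
      forall i L, T i *: v L = (Tdiag i L)%:A *: v L +
        (q^-1 + Tdiag i L)%:A *:
          oapp v 0 (insub (perm_tab (simple_tr i) (val L)))].

End Placed.

(* Main.v *)
(* If L = wC is standard, then for a reduced word w = s_{i_1} ... s_{i_p} every
   suffix s_{i_k} ... s_{i_p} C is standard: a left descent i of w means that
   i+1 precedes i in the column reading order, so i and i+1 may be swapped.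
   Hence T_w v_C is a multiple of v_L plus a combination of v_{L'} with L' = w'C
   and l(w') < l(w).  The multiple is a product of coefficients
   q^{-1} + (T_i)_{L'L'}, and such a coefficient vanishes only if c(L'(i)) =
   c(L'(i+1)) + 1.  Then the two boxes lie on adjacent diagonals, so one is weakly
   southeast of the other, and L' and s_i L' cannot both be standard.
   The transition matrix is therefore triangular with nonzero diagonal. *)
Require Import Defs.
From mathcomp Require Import all_boot all_order all_algebra all_fingroup.
From mathcomp Require Import reals sequences exp trigo complex.
From mathcomp Require Import zify ring lra.
Set Implicit Arguments.
Unset Strict Implicit.
Import Order.TTheory GRing.Theory Num.Theory.
Local Open Scope ring_scope.

(** * Words in simple transpositions and the exchange property *)

Lemma word_perm_cons n (i : 'I_n.-1) u j :
  ((word_perm (i :: u))^-1)%g j = ((word_perm u)^-1)%g (simple_tr i j).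
Proof. by rewrite /= invMg permM /simple_tr tpermV. Qed.

Lemma simple_tr_descent n (i : 'I_n.-1) (a b : 'I_n) :
  (a < b)%N -> (simple_tr i b < simple_tr i a)%N -> a = idx i /\ b = idxS i.
Proof.
rewrite /simple_tr => ab lt_s.
suff /andP[/eqP-> /eqP->] : (a == idx i) && (b == idxS i) by [].
move: ab lt_s; rewrite -2!val_eqE /=.
case: (tpermP (idx i) (idxS i) a) => [->|->|/eqP + /eqP];
  case: (tpermP (idx i) (idxS i) b) => [->|->|/eqP + /eqP];
  by rewrite -?val_eqE /=; lia.
Qed.

(* Following the pair [a < b] through the letters, some letter of the word
   swaps it; deleting that letter is multiplying by the transposition. *)
Lemma word_perm_exchange n (u : seq 'I_n.-1) (a b : 'I_n) :
  (a < b)%N -> ((word_perm u)^-1%g b < (word_perm u)^-1%g a)%N ->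
  exists2 u', (size u' < size u)%N & word_perm u' = (word_perm u * tperm a b)%g.
Proof.
elim: u a b => [|j u IH] a b ab.
  by rewrite /= invg1 !perm1; lia.
rewrite !word_perm_cons => desc.
case: (ltngtP (simple_tr j a) (simple_tr j b)) => [lt_s|gt_s|eq_s].
- have [u' su' u'E] := IH _ _ lt_s desc.
  exists (j :: u') => //=; rewrite u'E -tpermJ -!mulgA; congr (_ * _)%g.
  by rewrite /simple_tr tpermV tperm2 mulg1.
- have [-> ->] := simple_tr_descent ab gt_s.
  by exists u => //=; rewrite -mulgA tperm2 mulg1.
- by move/val_inj/perm_inj: eq_s ab => ->; rewrite ltnn.
Qed.

Lemma reduced_word_behead n (i : 'I_n.-1) u w :
  reduced_word (i :: u) w -> reduced_word u (word_perm u).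
Proof.
case=> <- min_u; split=> // u' u'E.
by have := min_u (i :: u'); rewrite /= u'E => /(_ erefl).
Qed.

(** Otherwise the exchange property, applied to [u] and the pair [idx i], [idxS i], would yield a
    word for [w] itself that is shorter than [u]. *)
Lemma reduced_word_descent n (i : 'I_n.-1) u w :
  reduced_word (i :: u) w -> (w^-1%g (idxS i) < w^-1%g (idx i))%N.
Proof.
case=> <- min_u; rewrite !word_perm_cons /simple_tr tpermL tpermR.
rewrite ltnNge leq_eqVlt negb_or; apply/andP; split.
  by apply/eqP => /val_inj/perm_inj/(congr1 val) /=; lia.
apply/negP => asc.
have [|u' su' u'E] := word_perm_exchange (u := u) (a := idx i) (b := idxS i) _ asc.
  by rewrite /=.
by have := min_u u' u'E; rewrite /= leqNgt ltnS ltnW.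
Qed.

(** * Standard tableaux under simple transpositions *)

Section Tableaux.
Variables (lam mu : seq nat) (n : nat).
Implicit Types t C : {ffun 'I_n -> box lam mu}.

Lemma standardP t : reflect
  [/\ injective t,
      forall i j, brow (t i) = brow (t j) -> (bcol (t i) < bcol (t j))%N -> (i < j)%N &
      forall i j, bcol (t i) = bcol (t j) -> (brow (t i) < brow (t j))%N -> (i < j)%N]
  (standard t).
Proof.
apply: (iffP and3P) => [[/injectiveP inj_t /forallP rowP /forallP colP]|].
  split=> // i j e l.
    by have /forallP/(_ j)/implyP := rowP i; rewrite e eqxx l; apply.
  by have /forallP/(_ j)/implyP := colP i; rewrite e eqxx l; apply.
case=> inj_t rowP colP; split; first exact/injectiveP.
  by apply/forallP=> i; apply/forallP=> j; apply/implyP=> /andP[/eqP]; apply: rowP.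
by apply/forallP=> i; apply/forallP=> j; apply/implyP=> /andP[/eqP]; apply: colP.
Qed.

Lemma perm_tab1 t : perm_tab 1%g t = t.
Proof. by apply/ffunP=> i; rewrite ffunE invg1 perm1. Qed.

Lemma perm_tab_simpleK i t : perm_tab (simple_tr i) (perm_tab (simple_tr i) t) = t.
Proof. by apply/ffunP=> j; rewrite !ffunE /simple_tr tpermV tpermK. Qed.

Lemma perm_tab_cons i u t :
  perm_tab (word_perm (i :: u)) t = perm_tab (simple_tr i) (perm_tab (word_perm u) t).
Proof. by apply/ffunP=> j; rewrite !ffunE word_perm_cons /simple_tr tpermV. Qed.

Lemma perm_tab_inj t (w w' : 'S_n) :
  injective t -> perm_tab w t = perm_tab w' t -> w = w'.
Proof.
move=> inj_t /ffunP eq_t; apply: invg_inj; apply/permP => i.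
by have := eq_t i; rewrite !ffunE => /inj_t.
Qed.

(* If [i+1] comes before [i] in the column reading order, then [i] is neither
   left of [i+1] in its row nor above it in its column. *)
Lemma standard_descent C i (w : 'S_n) :
  is_column_reading C -> standard (perm_tab w C) ->
  (w^-1%g (idxS i) < w^-1%g (idx i))%N ->
  standard (perm_tab (simple_tr i) (perm_tab w C)).
Proof.
move=> colC /standardP[inj_t rowP colP] desc.
have := colC (w^-1%g (idxS i)) (w^-1%g (idx i)); rewrite desc => /esym lexC.
(* The swap reverses a single pair of entries. All other pairs inherit their order from the old
   tableau, and [lexC] excludes the reversed pair below. *)
have swapped a b : (simple_tr i a < simple_tr i b)%N -> (a < b)%N \/
    (simple_tr i a = idx i /\ simple_tr i b = idxS i).
  case: (ltngtP a b) => [|lt_ba lt_s|/val_inj->]; [by left | | by rewrite ltnn].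
  have [-> ->] := simple_tr_descent lt_ba lt_s.
  by right; rewrite /simple_tr tpermL tpermR.
apply/standardP; split.
- by move=> a b; rewrite [_ a]ffunE [_ b]ffunE => /inj_t/perm_inj.
- move=> a b; rewrite [_ a]ffunE [_ b]ffunE /simple_tr !tpermV -/(simple_tr i).
  move=> eq_row lt_col; have [//|[ea eb]] := swapped a b (rowP _ _ eq_row lt_col).
  by move: eq_row lt_col lexC; rewrite ea eb !ffunE; lia.
- move=> a b; rewrite [_ a]ffunE [_ b]ffunE /simple_tr !tpermV -/(simple_tr i).
  move=> eq_col lt_row; have [//|[ea eb]] := swapped a b (colP _ _ eq_col lt_row).
  by move: eq_col lt_row lexC; rewrite ea eb !ffunE; lia.
Qed.

(* A skew shape contains the top right corner of the rectangle spanned by any two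
   of its boxes, so entries increase from northwest to southeast. *)
Lemma standard_lt_southeast t i j :
  is_skew_shape lam mu -> #|{: box lam mu}| = n -> standard t -> i != j ->
  (brow (t i) <= brow (t j))%N -> (bcol (t i) <= bcol (t j))%N -> (i < j)%N.
Proof.
move=> [/andP[lam_sorted _] _ _] card_box /standardP[inj_t rowP colP].
move=> neq_ij le_row le_col.
have antitone s r r' : sorted geq s -> (r <= r')%N -> (nth 0 s r' <= nth 0 s r)%N.
  move=> s_sorted le_r; case: (ltnP r' (size s)) => [lt_r'|]; last first.
    by move=> le_s; rewrite nth_default.
  have geq_trans : transitive geq by move=> b a c /= ba cb; exact: leq_trans cb ba.
  by apply: (sorted_leq_nth geq_trans leqnn) => //; rewrite inE; lia.
have skewP k : (nth 0 mu (brow (t k)) <= bcol (t k) < nth 0 lam (brow (t k)))%N.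
  exact: (valP (t k)).
have corner_in : @in_skew lam mu ((val (t i)).1, (val (t j)).2).
  apply/andP; split => /=.
    by have /andP[le_i _] := skewP i; exact: leq_trans le_i le_col.
  have /andP[_ lt_j] := skewP j; apply: leq_trans lt_j _.
  exact: antitone.
(* Counting boxes makes [t] surjective, so the corner box carries an entry [k], and i <= k <= j
   along its row and its column. *)
have [t' _ t'K] : bijective t by apply: inj_card_bij; rewrite // card_box card_ord.
pose k := t' (Sub _ corner_in : box lam mu).
have row_k : brow (t k) = brow (t i) by rewrite t'K /brow /bcol SubK.
have col_k : bcol (t k) = bcol (t j) by rewrite t'K /brow /bcol SubK.
have eq_box a b : brow (t a) = brow (t b) -> bcol (t a) = bcol (t b) -> a = b.
  move=> eq_row eq_col; apply/inj_t/val_inj.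
  by move: eq_row eq_col; rewrite /brow /bcol; case: (val (t a)) => ra sa; case: (val (t b)) => rb sb /=
    /val_inj-> /val_inj->.
have le_ik : (i <= k)%N.
  have [e|] := eqVneq (bcol (t i)) (bcol (t k)); first by rewrite (eq_box i k).
  by move=> ne; apply/ltnW/rowP; rewrite ?row_k //; lia.
have le_kj : (k <= j)%N.
  have [e|] := eqVneq (brow (t k)) (brow (t j)); first by rewrite (eq_box k j).
  by move=> ne; apply/ltnW/colP; rewrite ?col_k //; lia.
by rewrite ltn_neqAle neq_ij (leq_trans le_ik).
Qed.

Lemma standard_swap_diag i t :
  is_skew_shape lam mu -> #|{: box lam mu}| = n ->
  standard t -> standard (perm_tab (simple_tr i) t) ->
  bdiag (t (idx i)) != bdiag (t (idxS i)) + 1.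
Proof.
move=> skewP card_box t_std s_std; apply/eqP; rewrite /bdiag => diagE.
have neq_i : idx i != idxS i by rewrite -val_eqE /=; lia.
have lt_se := standard_lt_southeast skewP card_box.
(* Either the box of i+1 is weakly northwest of that of i, which [t] forbids, or the reverse holds,
   which the swapped tableau forbids. *)
have [le_row|lt_row] := leqP (brow (t (idxS i))) (brow (t (idx i))).
  have := lt_se _ (idxS i) (idx i) t_std; rewrite eq_sym neq_i /=; lia.
have := lt_se _ (idxS i) (idx i) s_std; rewrite eq_sym neq_i !ffunE.
rewrite /simple_tr tpermV tpermL tpermR /=; lia.
Qed.

End Tableaux.

(** * Periods of the complex exponential and the off-diagonal coefficients *)

Section ComplexExponential.
Variable R : realType.
Local Notation C := R[i].
Local Open Scope complex_scope.

Lemma cos_eq1_period (y : R) : cos y = 1 -> exists k : int, y = k%:~R * (pi *+ 2).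
Proof.
move=> cos_y; pose k := Num.floor (y / (pi *+ 2)); exists k.
have pi2_gt0 : 0 < pi *+ 2 :> R by rewrite pmulrn_lgt0 // pi_gt0.
have cos_period (m : int) : cos (m%:~R * (pi *+ 2)) = 1 :> R.
  have cos_nat (j : nat) : cos (j%:R * (pi *+ 2)) = 1 :> R.
    by have := periodicn (@cosD2pi R) j 0; rewrite add0r cos0 mulr_natl.
  by case: m => j; rewrite ?NegzE ?mulrNz ?mulNr ?cosN; exact: cos_nat.
have := floor_itv (y / (pi *+ 2)); rewrite -/k ler_pdivlMr // ltr_pdivrMr // => /andP[ge_y lt_y].
have sin_y : sin y = 0 by apply/eqP; rewrite -norm_cos_eq1 cos_y normr1.
pose t := y - k%:~R * (pi *+ 2).
have cos_t : cos t = 1 by rewrite cosB cos_y cos_period sin_y mul0r addr0 mul1r.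
have t_ge0 : 0 <= t by rewrite subr_ge0.
have t_lt : t < pi *+ 2.
  by rewrite ltrBlDl -[X in _ + X]mul1r -mulrDl; rewrite rmorphD /= in lt_y.
have pi0 := pi_ge0 R.
suff t0 : t = 0 by apply/eqP; rewrite -subr_eq0 -/t t0.
(* Cosine is injective on [0, pi]. Beyond pi the argument is reflected to [pi *+ 2 - t], and the
   outcome t = 2 pi contradicts [t_lt]. *)
have [le_t|gt_t] := leP t pi.
  by apply: cos_inj; rewrite ?cos_t ?cos0 // in_itv /= ?t_ge0 ?le_t ?lexx ?pi0.
have : pi *+ 2 - t = 0.
  apply: cos_inj; rewrite ?in_itv /= ?lexx ?pi0 //.
    by apply/andP; split; move: t_lt gt_t; rewrite mulr2n; lra.
  by rewrite cosB cos2pi sin2pi mul0r addr0 mul1r cos_t cos0.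
by move/eqP; rewrite subr_eq0 => /eqP e; rewrite e ltxx in t_lt.
Qed.

Lemma cexpD (z w : C) : cexp (z + w) = cexp z * cexp w.
Proof.
case: z w => [a b] [c d]; rewrite /cexp /= expRD cosD sinD.
by simpc; congr (_ +i* _); ring.
Qed.

Lemma cexpB (z w : C) : cexp (z - w) * cexp w = cexp z.
Proof. by rewrite -cexpD subrK. Qed.

Lemma cexp_neq0 (z : C) : cexp z != 0.
Proof.
have cexp0 : cexp 0 = 1 :> C by rewrite /cexp /= expR0 cos0 sin0; simpc.
have := cexpB 0 z; rewrite cexp0; case: eqP => // ->; rewrite mulr0.
by move/esym/eqP; rewrite oner_eq0.
Qed.

Lemma cexp_eq1 (z : C) : cexp z = 1 -> exists k : int, z = 0 +i* (k%:~R * (pi *+ 2)).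
Proof.
case: z => a b; rewrite /cexp /=; simpc => -[ecos esin].
have normE : expR a ^+ 2 = 1.
  by rewrite -[LHS]mulr1 -[X in _ * X](cos2Dsin2 b) mulrDr -!exprMn ecos esin expr1n expr0n addr0.
have expa : expR a = 1.
  by apply/eqP; rewrite -(@pexpr_eq1 _ _ 2) ?expR_ge0 // normE.
have a0 : a = 0 by apply: expR_inj; rewrite expa expR0.
move: ecos; rewrite expa mul1r => /cos_eq1_period[k ->].
by exists k; rewrite a0.
Qed.

(** The periods of [cexp] give a - b - 1 = i k W with W = 2 pi / [lnq2]. Hence the imaginary parts
    of a and b differ by k Re W, while the strip has height |Re W| and is half-open, so k = 0. *)
Lemma qpow2_sub_eq (lnq2 a b : C) :
  in_strip lnq2 a -> in_strip lnq2 b ->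
  qpow2 lnq2 (a - b) = cexp lnq2 -> a = b + 1.
Proof.
rewrite /in_strip => /andP[a_ge0 a_lt] /andP[b_ge0 b_lt] eq_q.
(* With [lnq2] = 0, division by zero would give the strip height 0, leaving no room for [a]. *)
have lnq2_neq0 : lnq2 != 0.
  by apply: contraTneq a_lt => ->; rewrite invr0 mulr0 normr0 -leNgt.
have [k kE] : exists k : int, lnq2 * (a - b) - lnq2 = 0 +i* (k%:~R * (pi *+ 2)).
  apply: cexp_eq1; apply: (mulIf (cexp_neq0 lnq2)).
  by rewrite cexpB mul1r.
pose W := (pi *+ 2)%:C / lnq2.
have abE : a - b - 1 = (0 +i* k%:~R) * W.
  apply: (mulIf lnq2_neq0); rewrite /W -mulrA mulfVK //.
  rewrite mulrBl mul1r [_ * lnq2]mulrC kE; simpc.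
  by [].
have imE : complex.Im a - complex.Im b = k%:~R * complex.Re W.
  have := congr1 (@complex.Im R) abE; rewrite -/W; case: (W) => w1 w2.
  by case: (a) (b) => [? ?] [? ?]; simpc => /= ->.
have lt_ab : `|complex.Im a - complex.Im b| < `|complex.Re W|.
  by rewrite ltr_norml; apply/andP; split; move: a_lt b_lt; rewrite -/W; lra.
have k0 : k = 0.
  apply: contraTeq lt_ab => k_neq0; rewrite -leNgt imE normrM ler_peMl //.
  rewrite -intr_norm -[1]/(1%:~R) ler_int; lia.
by apply/eqP; rewrite addrC -subr_eq -subr_eq0 abE k0; simpc.
Qed.

End ComplexExponential.

(** With z = q^{2(a-b)} the coefficient is (q^2 - z) / (q (1 - z)), which vanishes only at z =
    q^2. *)
Lemma Tcoef_neq0 (R : realType) (q lnq2 : R[i]) (a b : R[i]) :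
  q != 0 -> q ^+ 2 = cexp lnq2 -> in_strip lnq2 a -> in_strip lnq2 b -> a != b + 1 ->
  q^-1 + (q - q^-1) / (1 - qpow2 lnq2 (a - b)) != 0.
Proof.
move=> q_neq0 q2E a_strip b_strip; apply: contra_neq => coef0.
apply: (qpow2_sub_eq a_strip b_strip); rewrite -q2E.
set z := qpow2 _ _ in coef0 *.
(* At z = 1 the quotient takes the default value 0, and the coefficient is q^{-1}. *)
have [z1|z_neq1] := eqVneq z 1.
  move: coef0; rewrite z1 subrr invr0 mulr0 addr0 => /eqP.
  by rewrite invr_eq0 (negPf q_neq0).
have nz : 1 - z != 0 by rewrite subr_eq0 eq_sym.
have : q * (1 - z) * (q^-1 + (q - q^-1) / (1 - z)) = 0 by rewrite coef0 mulr0.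
have -> : q * (1 - z) * (q^-1 + (q - q^-1) / (1 - z)) = q ^+ 2 - z by field; rewrite q_neq0 nz.
by move/eqP; rewrite subr_eq0 => /eqP.
Qed.

(** * Triangular changes of basis *)

Section TriangularBasis.
Variables (K : fieldType) (H : algType K) (M : lmodType H).
Implicit Types (m : M) (a b : K).

Lemma scaleAD a b m : (a + b)%:A *: m = a%:A *: m + b%:A *: m.
Proof. by rewrite scalerDl scalerDl. Qed.

Lemma scaleAM a b m : (a * b)%:A *: m = a%:A *: (b%:A *: m).
Proof. by rewrite scalerA -scalerAl mul1r scalerA. Qed.

Lemma scaleA1 m : (1 : K)%:A *: m = m.
Proof. by rewrite scale1r scale1r. Qed.

Lemma scaleA0 m : (0 : K)%:A *: m = 0.
Proof. by rewrite scale0r scale0r. Qed.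

Lemma scaleAC (h : H) a m : h *: (a%:A *: m) = a%:A *: (h *: m).
Proof. by rewrite !scalerA mulr_algl mulr_algr. Qed.

Variable I : finType.

Definition span_on (P : pred I) (v : I -> M) m :=
  exists f : I -> K, m = \sum_(i | P i) (f i)%:A *: v i.

Lemma span_on0 P v : span_on P v 0.
Proof. by exists (fun=> 0); rewrite big1 // => i _; rewrite scaleA0. Qed.

Lemma span_onD P v m m' : span_on P v m -> span_on P v m' -> span_on P v (m + m').
Proof.
move=> [f ->] [g ->]; exists (fun i => f i + g i).
by rewrite -big_split; apply: eq_bigr => i _; rewrite scaleAD.
Qed.

Lemma span_onZ P v a m : span_on P v m -> span_on P v (a%:A *: m).
Proof.
move=> [f ->]; exists (fun i => a * f i).
by rewrite scaler_sumr; apply: eq_bigr => i _; rewrite scaleAM.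
Qed.

Lemma span_on_sum P v (J : finType) (Q : pred J) (F : J -> M) :
  (forall j, Q j -> span_on P v (F j)) -> span_on P v (\sum_(j | Q j) F j).
Proof.
move=> FP; elim/big_rec: _ => [|j m Qj mP]; first exact: span_on0.
by apply: span_onD => //; exact: FP.
Qed.

Lemma span_on_mem (P : pred I) v i : P i -> span_on P v (v i).
Proof.
move=> Pi; exists (fun j => (j == i)%:R).
rewrite (bigD1 i) //= eqxx scaleA1 big1 ?addr0 // => j /andP[_ /negPf->].
exact: scaleA0.
Qed.

(** Indices of equal [len] do not interact, so a grading suffices and no total order is chosen.
    Spanning follows by induction on [len], independence from a coefficient of maximal [len]. *)
Lemma triangular_is_basis (len : I -> nat) (v n : I -> M) :
  is_basis v ->
  (forall i, exists a m, [/\ a != 0, n i = a%:A *: v i + m &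
    span_on (fun j => (len j < len i)%N) v m]) ->
  is_basis n.
Proof.
move=> v_basis n_tri m.
have span_n i : span_on xpredT n (v i).
  have [k] := ubnP (len i); elim: k i => // k IH i le_i.
  have [a [m' [a_neq0 nE [f m'E]]]] := n_tri i.
  have -> : v i = a^-1%:A *: n i + (- a^-1)%:A *: m'.
    rewrite nE scalerDr -addrA -scaleAM mulVf // scaleA1 -scaleAD subrr scaleA0.
    by rewrite addr0.
  apply: span_onD; apply: span_onZ; first exact: span_on_mem.
  rewrite m'E; apply: span_on_sum => j lt_j; apply/span_onZ/IH; lia.
have v_free (g : I -> K) : \sum_i (g i)%:A *: v i = 0 -> forall i, g i = 0.
  move=> g0 i; have [f [_ f_uniq]] := v_basis 0.
  have /ffunP/(_ i) : f = [ffun i => g i].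
    by apply: f_uniq; rewrite -[LHS]g0; apply: eq_bigr => j _; rewrite ffunE.
  rewrite ffunE => <-; have /ffunP/(_ i) : f = [ffun=> 0].
    by apply: f_uniq; rewrite big1 // => j _; rewrite ffunE scaleA0.
  by rewrite ffunE.
have n_free (g : I -> K) : \sum_i (g i)%:A *: n i = 0 -> forall i, g i = 0.
  move=> g0 i0; apply/eqP; apply: contraT => g_i0.
  (* For this [i], only [n i] contributes to the coefficient of [v i]: any other [n j] involving
     [v i] has larger [len], hence [g j] = 0. *)
  case: (@arg_maxnP _ i0 (fun i => g i != 0) len g_i0) => i g_i max_i.
  have [a /fin_all_exists[m' n'E]] := fin_all_exists n_tri.
  have /fin_all_exists[f m'E] j : exists fj : I -> K,
      m' j = \sum_(k | (len k < len j)%N) (fj k)%:A *: v k.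
    by case: (n'E j).
  (* The transition matrix from [v] to [n], filled with zeros outside the triangle. *)
  pose A j k := if k == j then a j else if (len k < len j)%N then f j k else 0.
  have nE j : n j = \sum_k (A j k)%:A *: v k.
    have [_ -> _] := n'E j; rewrite m'E [RHS](bigD1 j) //= [A j j]/A eqxx; congr (_ + _).
    rewrite big_mkcond [RHS]big_mkcond; apply: eq_bigr => k _; rewrite /A.
    have [->|_] := eqVneq k j; first by rewrite ltnn.
    by case: ifP => //= _; rewrite scaleA0.
  have /v_free/(_ i) : \sum_k (\sum_j g j * A j k)%:A *: v k = 0.
    rewrite -[RHS]g0; under [RHS]eq_bigr do rewrite nE scaler_sumr.
    rewrite exchange_big; apply: eq_bigr => k _.
    by rewrite !scaler_suml; apply: eq_bigr => j _; rewrite scaleAM.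
  rewrite (bigD1 i) //= [A i i]/A eqxx big1 ?addr0.
    by move/eqP; rewrite mulf_eq0 (negPf g_i); case: (n'E i) => /negPf->.
  move=> j ne_ji; rewrite /A eq_sym (negPf ne_ji).
  case: ifP => [lt_ij|]; last by rewrite mulr0.
  have [->|/max_i] := eqVneq (g j) 0; first by rewrite mul0r.
  by rewrite /= leqNgt lt_ij.
have [f mE] : span_on xpredT n m.
  have [f [-> _]] := v_basis m.
  by apply: span_on_sum => i _; exact/span_onZ.
exists [ffun i => f i]; split=> [|g].
  by rewrite mE; apply: eq_bigr => i _; rewrite ffunE.
rewrite mE => fgE; apply/ffunP => i; rewrite ffunE; apply/eqP.
rewrite -subr_eq0; apply/eqP; apply: (n_free (fun i => f i - g i)).
under eq_bigr do rewrite scalerBl scalerBl.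
by rewrite sumrB fgE subrr.
Qed.

End TriangularBasis.

(** * Triangularity of the vectors T_w v_C *)

Theorem proposition5p3 (R : realType) (q lnq2 : R[i])
  (q_neq0 : q != 0) (q_nroot : not_root_of_unity q)
  (lnq2P : cexp lnq2 = q ^+ 2)
  (lam mu : seq nat) (skewP : is_skew_shape lam mu)
  (n : nat) (cardP : #|{: box lam mu}| = n)
  (c : box lam mu -> R[i]) (placedP : is_placed lnq2 c)
  (H : algType R[i]) (T : 'I_n.-1 -> H) (x xV : 'I_n -> H)
  (HeckeP : is_affine_Hecke_algebra q T x xV)
  (Tw : 'S_n -> H) (TwP : is_Tw T Tw)
  (M : lmodType H) (v : syt lam mu n -> M)
  (moduleP : is_skew_module q lnq2 c T x v)
  (C : syt lam mu n) (colP : is_column_reading (val C))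
  (w : syt lam mu n -> 'S_n)
  (wP : forall L, val L = perm_tab (w L) (val C)) :
  is_basis (fun L => Tw (w L) *: v C).
Proof.
have [v_basis _ Tv] := moduleP.
have [c_strip _ c_adj _] := placedP.
(* The word along which [Tw] is computed is fixed for each [L]; its size is the Coxeter length of
   [w L]. *)
have /fin_all_exists[word wordP] L : exists u, reduced_word u (w L) /\
    Tw (w L) = \prod_(i <- u) T i by have [u] := TwP (w L); exists u.
have C_inj : injective (val C) by have /standardP[] := valP C.
pose len L := size (word L).
(* As [C] is injective, the tableau determines its permutation, so any word leading from [C] to [L],
   reduced or not, bounds [len L]. *)
have len_le L u : val L = perm_tab (word_perm u) (val C) -> (len L <= size u)%N.
  rewrite (wP L) => /(perm_tab_inj C_inj) wE.
  by have [[_ min_u] _] := wordP L; exact: min_u.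
pose low p := span_on (fun L => (len L < p)%N) v.
have len_swap i L L' : val L' = perm_tab (simple_tr i) (val L) -> (len L' <= (len L).+1)%N.
  move=> L'E; have [[wE _] _] := wordP L.
  by apply: (len_le _ (i :: word L)); rewrite perm_tab_cons wE -wP.
have T_low p i m : low p m -> low p.+1 (T i *: m).
  case=> f ->; rewrite scaler_sumr; apply: span_on_sum => L lt_L.
  rewrite scaleAC Tv; apply/span_onZ/span_onD; apply: span_onZ.
    by apply: span_on_mem; exact: ltnW.
  case: insubP => [L' _ L'E|_] /=; last exact: span_on0.
  by apply: span_on_mem; apply: leq_ltn_trans (len_swap _ _ _ L'E) _.
(* Stated for arbitrary reduced words, since the tail of [word L] need not be the word chosen for
   the smaller tableau. *)
have leading u L : reduced_word u (word_perm u) ->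
    val L = perm_tab (word_perm u) (val C) ->
    exists a m, [/\ a != 0, (\prod_(i <- u) T i) *: v C = a%:A *: v L + m & low (size u) m].
  elim: u L => [|i u IH] L red_u LE.
    exists 1, 0; split; rewrite ?oner_eq0 //; last exact: span_on0.
    by rewrite big_nil scale1r scaleA1 addr0; congr v; apply: val_inj; rewrite LE perm_tab1.
  have red_u' := reduced_word_behead red_u.
  have L'_std : standard (perm_tab (word_perm u) (val C)).
    rewrite -[perm_tab _ _](perm_tab_simpleK i) -perm_tab_cons.
    apply: standard_descent => //; first by rewrite -LE; exact: (valP L).
    exact: reduced_word_descent red_u.
  pose L' : syt lam mu n := Sub _ L'_std.
  have L'E : val L' = perm_tab (word_perm u) (val C) by rewrite SubK.
  have LE' : perm_tab (simple_tr i) (val L') = val L by rewrite LE perm_tab_cons L'E.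
  have [a [m [a_neq0 uE m_low]]] := IH L' red_u' L'E.
  pose k := q^-1 + Tdiag q lnq2 c i L'.
  have k_neq0 : k != 0.
    apply: Tcoef_neq0 => //; rewrite ?lnq2P //.
    apply/eqP => /c_adj /eqP; apply/negP/standard_swap_diag => //.
    by rewrite LE'; exact: (valP L).
  (* The diagonal term of [T i] on [v L'] joins the lower part because [len L'] is at most the size
     of [u]. *)
  exists (a * k), ((a * Tdiag q lnq2 c i L')%:A *: v L' + T i *: m).
  split; first by rewrite mulf_neq0.
    rewrite big_cons -scalerA uE scalerDr scaleAC Tv LE' valK /= -/k.
    by rewrite scalerDr -!scaleAM addrA [X in X + _]addrC.
  apply: span_onD; last exact: T_low.
  by apply/span_onZ/span_on_mem; rewrite /= ltnS len_le.
apply: (@triangular_is_basis _ _ _ _ len v) => // L.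
have [[wE min_u] ->] := wordP L.
by apply: leading; rewrite wE.
Qed.
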